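(* Let $l$ be a positive integer, let $X$ be a measurable space, let $Y=\{-1,1\}$ and $Z = X \times Y$, and let $p$ be a permutation measure of impossibility on $Z^{l+1}$. Let $P$ be a continuous probability distribution on $Z$, and let $z_i=(x_i,y_i)$, $i=1,\dots,l+1$, be generated independently from $P$. Given $z_1,\dots,z_l,x_{l+1}$, put $$\mu_{-1} = \frac{1}{p(z_1,\ldots,z_l,(x_{l+1},-1))},\qquad \mu_{1} = \frac{1}{p(z_1,\ldots,z_l,(x_{l+1},1))},\qquad \mu=\min(\mu_{-1},\mu_1).$$ Let the prediction $\hat y\in\{-1,1\}$ for $y_{l+1}$ be $1$ if $\mu_{-1}<\mu_1$, $-1$ if $\mu_{-1}>\mu_1$, and arbitrary if $\mu_{-1}=\mu_1$ (chosen as a measurable function of $z_1,\dots,z_l,x_{l+1}$). Then for every constant $\epsilon>0$, $$P^{l+1}\{\mu\le\epsilon \text{ and } \hat y\neq y_{l+1}\}\le\epsilon .$$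
   Context: A probability distribution $P$ on $Z$ is continuous if it gives probability $0$ to every single point of $Z$. $P^{l+1}$ denotes the product distribution on $Z^{l+1}$. For a positive integer $m$, a permutation measure of impossibility on $Z^m$ is a non-negative measurable function $p$ on $Z^m$ (the value $\infty$ being allowed, so $p:Z^m\to[0,\infty]$) such that for every sequence $(z_1,\dots,z_m)\in Z^m$: (i) $p(z_1,\ldots,z_m)=\infty$ if $z_i=z_j$ for some $i\neq j$; (ii) if $z_1,\dots,z_m$ are all different, then $\frac{1}{m!}\sum_{\pi} p(z_{\pi(1)},\ldots,z_{\pi(m)})=1$, where the sum is over all permutations $\pi$ of $\{1,\dots,m\}$. Conventions: $1/0=\infty$ and $1/\infty=0$. *)

(* Defs.v *)
From HB Require Import structures.
From mathcomp Require Import all_boot all_order all_fingroup all_algebra.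
From mathcomp Require Import all_classical all_reals all_analysis measurable_realfun.
Set Implicit Arguments.
Unset Strict Implicit.
Unset Printing Implicit Defensive.
Import Order.TTheory GRing.Theory Num.Theory.
Local Open Scope classical_set_scope.
Local Open Scope ring_scope.
Local Open Scope ereal_scope.

(** The product distribution [P^n] on [n.-tuple T], where tuples carry the
    sigma-algebra generated by the coordinate projections: [P^0] is the Dirac
    mass at the empty tuple, and [P^(n+1)] is the image of [P \x P^n] under
    [(x, t) |-> x :: t]. *)
Section power_probability.
Context d (T : measurableType d) (R : realType).

Definition tuple_cons n (xt : T * n.-tuple T) : n.+1.-tuple T :=
  [tuple of xt.1 :: xt.2].

Lemma measurable_tuple_cons n : measurable_fun [set: _] (@tuple_cons n).
Proof. exact: measurable_cons. Qed.

HB.instance Definition _ n :=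
  isMeasurableFun.Build _ _ _ _ (@tuple_cons n) (@measurable_tuple_cons n).

Fixpoint power_probability (P : probability T R) (n : nat) :
    probability (n.-tuple T) R :=
  match n with
  | 0%N => \d_([tuple] : 0.-tuple T)
  | m.+1 => distribution (P \x power_probability P m) (@tuple_cons m)
  end.

Lemma power_probability_box (P : probability T R) n (A : 'I_n -> set T) :
  (forall i, measurable (A i)) ->
  power_probability P n [set t | forall i, A i (tnth t i)] =
  \prod_(i < n) P (A i).
Proof.
elim: n A => [|n IHn] A mA.
  rewrite big_ord0 /= diracE mem_set//.
  by move=> -[].
rewrite big_ord_recl -IHn; last by move=> i; exact: mA.
rewrite /= /distribution /pushforward /=.
set B := [set t : n.-tuple T | _].
rewrite -product_measure1E //; last first.
  rewrite (_ : B = \big[setI/setT]_(i < n)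
      ((fun t : n.-tuple T => tnth t i) @^-1` A (lift ord0 i))).
    apply: big_ind => // [|i _]; first exact: measurableI.
    rewrite -[X in measurable X]setTI; apply: measurable_tnth => //.
  apply/seteqP; split=> t.
    move=> Bt; apply: (@big_ind _ (fun C : set _ => C t)) => //.
    by move=> i _; exact: Bt.
  by move=> + i; rewrite (bigD1 i)//= => -[].
congr ((P \x _) _); apply/seteqP; split=> -[x t] /=.
  move=> h; split; first by have := h ord0; rewrite /tuple_cons tnth0.
  by move=> i; have := h (lift ord0 i); rewrite /tuple_cons tnthS.
move=> [Ax Bt] i; have [j ->|->] := unliftP ord0 i; last by rewrite tnth0.
by rewrite /tuple_cons tnthS; exact: Bt.
Qed.

(** [P] gives probability 0 to every point. Singletons of an arbitrary
    measurable space need not be measurable, and [P] is meaningless outside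
    measurable sets, so "probability 0" is rendered by negligibility: [[set z]]
    is contained in a measurable set of probability 0. For measurable
    singletons this is [P [set z] = 0] ([negligibleP]). *)
Definition continuous_probability (P : probability T R) : Prop :=
  forall z : T, P.-negligible [set z].

Record permutation_measure_of_impossibility (m : nat)
    (p : m.-tuple T -> \bar R) : Prop := {
  impossibility_ge0 : forall z, 0 <= p z ;
  impossibility_measurable : measurable_fun [set: m.-tuple T] p ;
  impossibility_repeated : forall (z : m.-tuple T) (i j : 'I_m),
    i <> j -> tnth z i = tnth z j -> p z = +oo ;
  impossibility_average : forall z : m.-tuple T,
    injective (tnth z) ->
    (m`!%:R^-1)%:E * (\sum_(s : 'S_m) p [tuple tnth z (s i) | i < m]) = 1
}.

End power_probability.

(** Examples are pairs [(x, y)] of an object and a label. The two-element label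
    space {-1, 1} is [bool] with its discrete sigma-algebra: [false] stands for
    -1 and [true] for 1. *)
Section prediction.
Context d (X : measurableType d) (R : realType) (l : nat).
Variable p : l.+1.-tuple (X * bool) -> \bar R.

(** 1 / p(z_1, ..., z_l, (x, y)) for [u = (z_1, ..., z_l)]. The inverse of
    [\bar R] satisfies [0^-1 = +oo] and [+oo^-1 = 0]. *)
Definition label_mu (u : l.-tuple (X * bool)) (x : X) (y : bool) : \bar R :=
  (p [tuple of rcons u (x, y)])^-1.

Definition min_mu (u : l.-tuple (X * bool)) (x : X) : \bar R :=
  Order.min (label_mu u x false) (label_mu u x true).

(** A prediction rule maps [((z_1, ..., z_l), x_(l+1))] to a label; ties are
    broken arbitrarily, but measurably. *)
Record prediction_rule (yhat : l.-tuple (X * bool) * X -> bool) : Prop := {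
  prediction_measurable : measurable_fun [set: l.-tuple (X * bool) * X] yhat ;
  prediction_pos : forall u x,
    label_mu u x false < label_mu u x true -> yhat (u, x) = true ;
  prediction_neg : forall u x,
    label_mu u x true < label_mu u x false -> yhat (u, x) = false
}.

End prediction.

(** (z_1, ..., z_l) out of (z_1, ..., z_(l+1)); the last one is
    [tnth z ord_max]. *)
Definition init_tuple (T : Type) (l : nat) (z : l.+1.-tuple T) : l.-tuple T :=
  [tuple tnth z (widen_ord (leqnSn l) i) | i < l].

(* Main.v *)
(** A wrong prediction means that the true label has the smaller mu, so the
    error event is contained in {p >= 1/eps}. Since P^(l+1) is invariant under
    permutations of the coordinates, the integral of p equals that of its average
    over all permutations, which is 1 outside the sequences with a repetition.
    These form a null set because P is continuous, and Markov's inequality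
    concludes. *)
From HB Require Import structures.
Require Import Defs.
From mathcomp Require Import all_boot all_order all_fingroup all_algebra.
From mathcomp Require Import all_classical all_reals all_analysis measurable_realfun.
Import Order.TTheory GRing.Theory Num.Theory.
Local Open Scope classical_set_scope.
Local Open Scope ring_scope.
Local Open Scope ereal_scope.

(** * Invariance of the power distribution under permutations of the coordinates *)

Section exchangeability.
Context d (T : measurableType d) (R : realType).

Definition tuple_perm n (s : 'S_n) (z : n.-tuple T) : n.-tuple T :=
  [tuple tnth z (s i) | i < n].

Lemma measurable_tuple_perm n (s : 'S_n) : measurable_fun setT (tuple_perm n s).
Proof.
apply/measurable_fun_tnthP => i.
rewrite (_ : _ \o _ = @tnth n T ^~ (s i)); first exact: measurable_tnth.
by apply/funext => z /=; rewrite tnth_mktuple.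
Qed.

HB.instance Definition _ n (s : 'S_n) :=
  isMeasurableFun.Build _ _ _ _ (tuple_perm n s) (measurable_tuple_perm n s).

(** The measurable rectangles: a family closed under intersection that generates the sigma-algebra
    of tuples, so finite measures of equal total mass are compared on it. *)
Definition tuple_boxes n : set_system (n.-tuple T) :=
  [set [set z | forall i, A i (tnth z i)] | A in
    [set A : 'I_n -> set T | forall i, measurable (A i)]].

Lemma measurable_tuple_box n (A : 'I_n -> set T) :
  (forall i, measurable (A i)) ->
  measurable [set z : n.-tuple T | forall i, A i (tnth z i)].
Proof.
move=> mA.
rewrite (_ : [set z | _] =
  \big[setI/setT]_(i < n) ((fun z : n.-tuple T => tnth z i) @^-1` A i)).
  apply: big_ind => // [|i _]; first exact: measurableI.
  by rewrite -[X in measurable X]setTI; exact: measurable_tnth.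
apply/seteqP; split=> z.
  move=> zA; apply: (@big_ind _ (fun C : set _ => C z)) => // i _.
  exact: zA.
by move=> + i; rewrite (bigD1 i)//= => -[].
Qed.

Lemma tuple_measurableE n :
  @measurable _ (n.-tuple T) = <<s @tuple_boxes n >>.
Proof.
apply/seteqP; split; last first.
  apply: smallest_sub; first exact: sigma_algebra_measurable.
  by move=> _ [A mA <-]; exact: measurable_tuple_box.
apply: smallest_sub; first exact: smallest_sigma_algebra.
rewrite -bigcup_seq; apply: bigcup_sub => i _ C [B mB <-].
apply: sub_sigma_algebra.
(* A generator constrains a single coordinate: it is the box whose other sides are all of [T]. *)
exists (fun j => if j == i then B else setT).
  by move=> j; case: ifP.
apply/seteqP; split=> z /= => [/(_ i)|[_ Bz] j]; first by rewrite eqxx.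
by case: eqP => // ->.
Qed.

(** Permuting coordinates only permutes the sides of a box, so the product of their probabilities is
    unchanged; agreement on boxes extends to all measurable sets by uniqueness of measures. *)
Lemma power_probability_perm (P : probability T R) n (s : 'S_n)
    (A : set (n.-tuple T)) : measurable A ->
  power_probability P n (tuple_perm n s @^-1` A) = power_probability P n A.
Proof.
move=> mA.
pose m1 : {measure set (n.-tuple T) -> \bar R} :=
  distribution (power_probability P n) (tuple_perm n s).
rewrite -[LHS]/(m1 A).
apply: (measure_unique (tuple_boxes n) (fun=> setT)) => //.
- exact: tuple_measurableE.
- move=> _ _ [A1 mA1 <-] [A2 mA2 <-].
  exists (fun i => A1 i `&` A2 i); first by move=> i; exact: measurableI.
  apply/seteqP; split=> z /=; first by move=> h; split=> i; have [] := h i.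
  by move=> [h1 h2] i; split.
- move=> _; exists (fun=> setT) => //; exact/seteqP.
- by rewrite bigcup_const.
- move=> _ [B mB <-].
  rewrite [RHS]power_probability_box//.
  rewrite -[LHS]/(power_probability P n (tuple_perm n s @^-1` _)).
  (* Coordinate [s i] of [z] is tested against [B i], so side [j] of the preimage is [B] at the
     inverse image of [j]. *)
  rewrite (_ : _ @^-1` _ =
    [set z | forall i, (B \o (s^-1)%g) i (tnth z i)]).
    rewrite power_probability_box; last by move=> i; exact: mB.
    rewrite [RHS](reindex_inj (@perm_inj _ s^-1%g)) /=.
    exact: eq_bigr.
  apply/seteqP; split=> z /= h i.
    by have := h (s^-1%g i); rewrite tnth_mktuple permKV.
  by rewrite tnth_mktuple; have := h (s i); rewrite permK.
- move=> _; rewrite (_ : m1 _ = 1) ?ltry//.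
  exact: (probability_setT (distribution (power_probability P n) (tuple_perm n s))).
Qed.

End exchangeability.
Arguments tuple_perm {d T n}.

(** * Sequences with a repetition form a null set *)

Section repetitions.
Context d (T : measurableType d) (R : realType).
Variable P : probability T R.
Hypothesis P_continuous : continuous_probability P.

Lemma negligible_mem_seq (s : seq T) : P.-negligible [set x | x \in s].
Proof.
elim: s => [|x s IHs].
  by apply: negligibleS (negligible_set0 P) => x /=; rewrite inE.
apply: negligibleS (negligibleU (P_continuous x) IHs) => y /=.
by rewrite inE => /orP[/eqP|]; [left|right].
Qed.

(* If t has a repetition, so has every x :: t; otherwise x :: t has one only
   for the finitely many x occurring in t. Hence the probability of the section
   at t is the indicator of the same event one dimension lower, which transfers
   measurability downwards and nullity upwards. *)
Lemma power_probability_repetition n :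
  measurable [set t : n.-tuple T | ~~ uniq t] ->
  power_probability P n [set t : n.-tuple T | ~~ uniq t] = 0.
Proof.
elim: n => [_|n IHn mN].
  by rewrite (_ : [set t | _] = set0) ?measure0//; apply/seteqP; split=> // -[[]].
set N := [set t : n.+1.-tuple T | _] in mN *.
pose A := @tuple_cons d T n @^-1` N.
have mA : measurable A.
  by rewrite -[A]setTI; exact: (@measurable_tuple_cons d T n).
have PA t : P (ysection A t) = (\1_[set t : n.-tuple T | ~~ uniq t] t)%:E.
  rewrite indicE; have [ut|nut] := boolP (uniq t).
    rewrite memNset /= ?ut//; apply/negligibleP; first exact: measurable_ysection.
    apply: negligibleS (negligible_mem_seq t) => x.
    by rewrite /ysection /= inE /A /N /= negb_and ut orbF negbK.
  rewrite mem_set// (_ : ysection A t = setT) ?probability_setT//.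
  apply/seteqP; split=> x // _.
  by rewrite /ysection /= inE /A /N /= negb_and nut orbT.
have mNn : measurable [set t : n.-tuple T | ~~ uniq t].
  rewrite (_ : [set t | _] =
    setT `&` (fun t => P (ysection A t)) @^-1` [set 1]).
    apply: (measurable_fun_ysection P mA) => //.
  rewrite setTI; apply/seteqP; split=> t /=; rewrite PA indicE.
    by move=> nut; rewrite mem_set.
  by case: (boolP (uniq t)) => // ut; rewrite memNset /= ?ut// => -[/eqP]; rewrite eq_sym oner_eq0.
rewrite -[LHS]/((P \x power_probability P n) A).
(* Both orders of iterated integration agree on rectangles, hence everywhere; the order with [t]
   outermost is the one that involves the sections computed in [PA]. *)
have -> : (P \x power_probability P n) A = (P \x^ power_probability P n) A.
  apply: product_measure_unique => // B C mB mC.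
  exact: product_measure2E.
rewrite /product_measure2 /=.
under eq_integral do rewrite PA.
by rewrite integral_indic// setIT; exact: IHn.
Qed.

End repetitions.
Arguments power_probability_repetition {d T R P}.

(** * The integral of [p] and Markov's inequality *)

Section impossibility.
Context d (T : measurableType d) (R : realType) (m : nat).
Variable p : m.-tuple T -> \bar R.
Hypothesis p_impossibility : permutation_measure_of_impossibility p.

Let avg (z : m.-tuple T) : \bar R :=
  (m`!%:R^-1)%:E * \sum_(s : 'S_m) p (tuple_perm s z).

Let mp_perm (s : 'S_m) : measurable_fun setT (fun z => p (tuple_perm s z)).
Proof.
apply: (measurableT_comp (impossibility_measurable p_impossibility)).
exact: measurable_tuple_perm.
Qed.

Let measurable_avg : measurable_fun setT avg.
Proof. by apply: measurable_funeM; apply: emeasurable_sum. Qed.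

Let avg_uniq (z : m.-tuple T) : uniq z -> avg z = 1.
Proof. by move/tuple_uniqP => /(impossibility_average p_impossibility). Qed.

(** Every rearrangement of a sequence with a repetition has a repetition too, so each term of the
    sum is infinite. *)
Let avg_repetition (z : m.-tuple T) : ~~ uniq z -> avg z = +oo.
Proof.
move=> nuz.
have [i [j [ij zij]]] : exists i j : 'I_m, i <> j /\ tnth z i = tnth z j.
  apply: contrapT => H; move/negP: nuz; apply; apply/tuple_uniqP => i j zij.
  by apply: contrapT => ij; apply: H; exists i, j.
have pz (s : 'S_m) : p (tuple_perm s z) = +oo.
  apply: (impossibility_repeated p_impossibility (i := s^-1%g i) (j := s^-1%g j)).
    by move/perm_inj.
  by rewrite !tnth_mktuple !permKV.
(* One infinite term suffices: the remaining sum is nonnegative, hence not [-oo], and the factor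
   [1/m!] is positive. *)
rewrite /avg (bigD1 1%g)//= pz addye.
  by rewrite gt0_muley// lte_fin invr_gt0 ltr0n fact_gt0.
rewrite -ltNye; apply: (@lt_le_trans _ _ 0) => //; apply: sume_ge0 => s _.
exact: (impossibility_ge0 p_impossibility).
Qed.

(* An arbitrary measurable space may have a non-measurable diagonal; here the
   existence of p forces the event to be measurable, as [avg] is +oo on it and
   1 off it. *)
Lemma measurable_repetition : measurable [set z : m.-tuple T | ~~ uniq z].
Proof.
rewrite (_ : [set z | _] = setT `&` avg @^-1` [set +oo]).
  exact: measurable_avg.
rewrite setTI; apply/seteqP; split=> z /=; first exact: avg_repetition.
by move=> avgz; apply/negP => /avg_uniq; rewrite avgz.
Qed.

Variable P : probability T R.
Hypothesis P_continuous : continuous_probability P.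

Lemma integral_impossibility : \int[power_probability P m]_z p z = 1.
Proof.
have p0 := impossibility_ge0 p_impossibility.
have mp := impossibility_measurable p_impossibility.
have int_perm (s : 'S_m) :
    \int[power_probability P m]_z p (tuple_perm s z) =
    \int[power_probability P m]_z p z.
  (* Change of variables: the left side integrates [p] against the image measure, which is the power
     distribution again. *)
  rewrite -[LHS](ge0_integral_pushforward (measurable_tuple_perm _ _ _ s)
    (power_probability P m) measurableT mp)//.
  apply: eq_measure_integral => A mA _.
  exact: power_probability_perm.
have : \int[power_probability P m]_z avg z = 1.
  rewrite -(probability_setT (power_probability P m)) -[RHS]mul1e -integral_cst//.
  apply: ae_eq_integral => //.
  exists [set z : m.-tuple T | ~~ uniq z]; split.
  - exact: measurable_repetition.
  - exact: (power_probability_repetition P_continuous _ measurable_repetition).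
  - by move=> z /=; apply: contra_notN => uz _; exact: avg_uniq.
rewrite ge0_integralZl//; last 2 first.
- exact: emeasurable_sum.
- by move=> z _; apply: sume_ge0.
rewrite ge0_integral_sum//.
under eq_bigr do rewrite int_perm.
(* The [m!] equal integrals cancel the factor [1/m!]. *)
rewrite sumr_const card_Sn.
rewrite (_ : (_ *+ _)%R = (m`!%:R)%:E * \int[power_probability P m]_z p z); last first.
  exact: esym (mule_natl _ _).
rewrite muleA -EFinM mulVf ?mul1e//.
Qed.

Lemma impossibility_markov (eps : R) : (0 < eps)%R ->
  power_probability P m [set z | (eps^-1)%:E <= p z] <= eps%:E.
Proof.
move=> eps0; have p0 := impossibility_ge0 p_impossibility.
have := @le_integral_abse _ _ _ (power_probability P m) setT measurableT p
  (eps^-1)%R (impossibility_measurable p_impossibility).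
rewrite invr_gt0 => /(_ eps0).
under eq_integral do rewrite gee0_abs//.
under eq_set do rewrite gee0_abs//.
rewrite setTI integral_impossibility.
by rewrite lee_pdivrMl// mule1.
Qed.

End impossibility.
Arguments impossibility_markov {d T R m p} _ {P} _ {eps}.

(** * Splitting off the last example, and the error bound *)

Lemma init_tupleK (T : Type) l (z : l.+1.-tuple T) :
  [tuple of rcons (init_tuple z) (tnth z ord_max)] = z.
Proof.
apply: eq_from_tnth => i.
rewrite (tnth_nth (tnth z i)) /= nth_rcons size_map size_enum_ord.
case: ltngtP => [il|il|il]; last by congr (tnth z _); apply/val_inj.
- rewrite -(tnth_nth _ (init_tuple z) (Ordinal il)) tnth_mktuple.
  by congr (tnth z _); apply/val_inj.
- by move: (ltn_ord i); rewrite ltnS leqNgt il.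
Qed.

Lemma measurable_init_tuple d (T : measurableType d) l :
  measurable_fun setT (@init_tuple T l).
Proof.
apply/measurable_fun_tnthP => i.
rewrite (_ : _ \o _ = @tnth _ T ^~ (widen_ord (leqnSn l) i)); first exact: measurable_tnth.
by apply/funext => z /=; rewrite tnth_mktuple.
Qed.

Lemma measurable_rcons d1 d2 (S : measurableType d1) (T : measurableType d2) l
    (f : S -> l.-tuple T) (g : S -> T) :
  measurable_fun setT f -> measurable_fun setT g ->
  measurable_fun setT (fun x => [tuple of rcons (f x) (g x)]).
Proof.
move=> /measurable_fun_tnthP mf mg; apply/measurable_fun_tnthP => i.
have [il|il] := ltnP i l.
  rewrite (_ : _ \o _ = @tnth l T ^~ (Ordinal il) \o f)//.
  apply/funext => x /=.
  by rewrite (tnth_nth (g x)) /= nth_rcons size_tuple il (tnth_nth (g x)).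
rewrite (_ : _ \o _ = g)//; apply/funext => x /=.
rewrite (tnth_nth (g x)) /= nth_rcons size_tuple ltnNge il /=.
by case: ifP.
Qed.

Theorem mainTheorem1 (R : realType) (d : measure_display)
    (X : measurableType d) (l : nat) (l_gt0 : (0 < l)%N)
    (p : l.+1.-tuple (X * bool) -> \bar R)
    (p_impossibility : permutation_measure_of_impossibility p)
    (P : probability (X * bool)%type R)
    (P_continuous : continuous_probability P)
    (yhat : l.-tuple (X * bool) * X -> bool)
    (yhat_rule : prediction_rule p yhat)
    (eps : R) (eps_gt0 : (0 < eps)%R) :
  power_probability P l.+1
    [set z : l.+1.-tuple (X * bool) |
      let u := init_tuple z in
      let x := (tnth z ord_max).1 in
      let y := (tnth z ord_max).2 in
      min_mu p u x <= eps%:E /\ yhat (u, x) <> y]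
  <= eps%:E.
Proof.
have p0 := impossibility_ge0 p_impossibility.
have mp := impossibility_measurable p_impossibility.
have mlast : measurable_fun setT (fun z : l.+1.-tuple (X * bool) => tnth z ord_max).
  exact: measurable_tnth.
have mx := measurableT_comp measurable_fst mlast.
have my := measurableT_comp measurable_snd mlast.
(* Inversion reverses the order on nonnegative extended reals, including the values 0 and [+oo]. *)
have mu_le u x y : (label_mu p u x y <= eps%:E) =
    ((eps^-1)%:E <= p [tuple of rcons u (x, y)]).
  have -> : (eps^-1)%:E = eps%:E^-1 by rewrite inver gt_eqF.
  by rewrite /label_mu inve_ple// inE// lee_fin ltW.
set E := [set z | _].
(* Monotonicity of measure needs the error event [E] to be measurable. [C y] says that the [mu] of
   label [y] is at most [eps]; [D y] below says that the true label is [y] and the prediction is the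
   other one. *)
pose C y := [set z : l.+1.-tuple (X * bool) |
  (eps^-1)%:E <= p [tuple of rcons (init_tuple z) ((tnth z ord_max).1, y)]].
have mC y : measurable (C y).
  rewrite -[C y]setTI; apply: emeasurable_fun_c_infty => //.
  apply: (measurableT_comp mp); apply: measurable_rcons.
    exact: measurable_init_tuple.
  by apply: measurable_fun_pair.
pose h (z : l.+1.-tuple (X * bool)) := yhat (init_tuple z, (tnth z ord_max).1).
have mh : measurable_fun setT h.
  apply: (measurableT_comp (prediction_measurable yhat_rule)).
  apply: measurable_fun_pair => //; exact: measurable_init_tuple.
pose D y := h @^-1` [set ~~ y] `&` (fun z => (tnth z ord_max).2) @^-1` [set y].
have mD y : measurable (D y).
  by apply: measurableI; rewrite -[X in measurable X]setTI; [exact: mh|exact: my].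
have EE : E = (C false `|` C true) `&` (D false `|` D true).
  apply/seteqP; split=> z; rewrite /E /C /D /h /= /min_mu ge_min !mu_le.
    move=> [/orP ? yhatN]; split => //; move: yhatN.
    by case: (yhat _) (tnth z ord_max).2 => -[]; auto.
  move=> [/orP ? H]; split => //.
  by case: H => -[-> ->].
apply: le_trans (impossibility_markov p_impossibility P_continuous eps_gt0).
apply: le_measure; rewrite ?inE.
- by rewrite EE; apply: measurableI; apply: measurableU.
- by rewrite -[X in measurable X]setTI; apply: emeasurable_fun_c_infty.
move=> z [/= + yhatN]; set u := init_tuple z in yhatN *; set x := _.1 in yhatN *.
(* The rule predicts the label with the strictly larger [mu], so on an error the true label attains
   the minimum; in a tie both labels do. The bound on [mu] is then a bound on [p] at [z] itself. *)
rewrite (_ : min_mu p u x = label_mu p u x (tnth z ord_max).2).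
  by rewrite mu_le -surjective_pairing init_tupleK.
rewrite /min_mu; case: ltgtP => [lt01|lt10|eq01].
- by move: yhatN; rewrite (prediction_pos yhat_rule lt01); case: (_.2).
- by move: yhatN; rewrite (prediction_neg yhat_rule lt10); case: (_.2).
- by case: (_.2); rewrite ?eq01.
Qed.
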